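(* Let $n$ be an integer with $n>1$, and let $a=n!\,2^{n^2}$, $b=2^{n^3}a^{n-1}$ and $r=2^{n^2-n}a$. Then $$\theta_{S(x^n)}<(b-1)2^{n-1}\left(r+\frac{2}{3}(b-1)(2^{2n}-1)+2(b-2)\right)^n-2a+ab.$$
   Context: For a positive integer $n$, $S(x^n)=(1^n,2^n,3^n,\ldots)$ is the sequence of $n$th powers of positive integers. For a sequence of integers $S=(s_1,s_2,\ldots)$, $P(S)$ is the set of all sums $\sum_{k=1}^{\infty}\epsilon_k s_k$ where each $\epsilon_k\in\{0,1\}$, all but finitely many $\epsilon_k$ are $0$, and at least one $\epsilon_k$ is $1$. $S$ is complete if $P(S)$ contains every sufficiently large integer. If $S$ is complete, its threshold of completeness $\theta_S$ is the largest integer that is not in $P(S)$. It is known that $S(x^n)$ is complete for every positive integer $n$. *)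

(* Defs.v *)
From HB Require Import structures.
From mathcomp Require Import all_boot all_order all_algebra.

Set Implicit Arguments.
Unset Strict Implicit.
Unset Printing Implicit Defensive.

Import Order.TTheory GRing.Theory Num.Theory.
Local Open Scope ring_scope.

(* Sequences (s_1, s_2, ...) of integers are functions s : nat -> int with the
   index shifted by one: [s k] is s_(k+1). *)

Definition power_seq (n : nat) : nat -> int := fun k => k.+1%:Z ^+ n.

(* The sum is taken up to a bound N beyond which all coefficients vanish. *)
Definition subset_sum (s : nat -> int) (m : int) : Prop :=
  exists (eps : nat -> bool) (N : nat),
    [/\ forall k, (N <= k)%N -> eps k = false,
        exists k, eps k
      & m = \sum_(k < N) (eps k)%:R * s k].

Definition complete (s : nat -> int) : Prop :=
  exists M : int, forall m : int, M <= m -> subset_sum s m.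

Definition is_threshold (s : nat -> int) (t : int) : Prop :=
  [/\ complete s,
      ~ subset_sum s t
    & forall m : int, ~ subset_sum s m -> m <= t].

(* Main.v *)
(* Iterating the differences f(x + h_i) - f(x) of f = x^n, with h_i = 2^(2i-1)
   for i = 1..n, gives the constant n! h_1...h_n = a, so the vertices of a cube
   of steps h_i split into two classes whose nth-power sums differ by a. Choosing
   one class in each of b - 1 disjoint cubes made of even numbers >= r yields all
   sums M + t a with 0 <= t < b. Below r, the numbers 2^i + k a with i < 2n and
   k < 2^n - 1 have nth powers congruent to (2^n)^i, each available 2^n - 1 times:
   these are digits in base 2^n, and they reach every residue modulo a with a sum
   at most C. The odd numbers above r have nth powers growing by a factor at most
   2, so their subset sums leave gaps at most D = (r + 1)^n. Since C + D <= a b,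
   every m >= M + C is a sum of distinct nth powers. *)

Require Import Defs.
From mathcomp Require Import all_boot all_order all_algebra.
From mathcomp Require Import zify ring.
From Stdlib Require Import Classical_Prop.
Import Order.TTheory GRing.Theory Num.Theory.
Local Open Scope ring_scope.

(** * Power sums and the geometry of signed cubes *)

Section Powers.
Local Open Scope nat_scope.

Definition power_sum (n : nat) (s : seq nat) : nat := \sum_(x <- s) x ^ n.

Lemma power_sum_cat n s1 s2 :
  power_sum n (s1 ++ s2) = power_sum n s1 + power_sum n s2.
Proof. by rewrite /power_sum big_cat. Qed.

Lemma leq_expn2r n x y : x <= y -> x ^ n <= y ^ n.
Proof. by case: n => // n; rewrite leq_exp2r. Qed.

Lemma power_sum_le n s m :
  (forall x, x \in s -> x <= m) -> power_sum n s <= size s * m ^ n.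
Proof.
rewrite /power_sum; elim: s => [|y s IHs] sm; first by rewrite big_nil.
rewrite big_cons mulSn leq_add //; first exact/leq_expn2r/sm/mem_head.
by apply: IHs => x xs; rewrite sm // inE xs orbT.
Qed.

(* The vertices of sign [sg] in the k-fold difference with steps 2^1, 2^3, ..., 2^(2k-1). *)
Fixpoint signed_cube (sg : bool) (k x : nat) : seq nat :=
  if k is k'.+1 then
    signed_cube sg k' (x + 2 ^ (2 * k' + 1)) ++ signed_cube (~~ sg) k' x
  else if sg then [:: x] else [::].

Definition cube_span (k : nat) : nat := \sum_(i < k) 2 ^ (2 * i + 1).

Lemma cube_spanS k : cube_span k.+1 = cube_span k + 2 ^ (2 * k + 1).
Proof. by rewrite /cube_span big_ord_recr. Qed.

(** A geometric series of ratio 4, kept free of subtraction; it is the source of the factor 2/3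
    (2^(2n) - 1) in the bound. *)
Lemma cube_spanE k : 3 * cube_span k + 2 = 2 * 2 ^ (2 * k).
Proof.
elim: k => [|k IHk]; first by rewrite /cube_span big_ord0.
rewrite cube_spanS mulnDr addnAC IHk mulnS addn1 !expnS; lia.
Qed.

Lemma cube_span_lt k : cube_span k < 2 ^ (2 * k + 1).
Proof. by have := cube_spanE k; rewrite addn1 expnS; lia. Qed.

Lemma signed_cube_range sg k x y :
  y \in signed_cube sg k x -> x <= y <= x + cube_span k.
Proof.
elim: k sg x => [|k IHk] sg x /=.
  by case: sg; rewrite ?in_nil // inE => /eqP ->; rewrite leqnn leq_addr.
by rewrite mem_cat cube_spanS => /orP[] /IHk; lia.
Qed.

Lemma signed_cube_even sg k x y :
  ~~ odd x -> y \in signed_cube sg k x -> ~~ odd y.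
Proof.
elim: k sg x => [|k IHk] sg x x_even /=.
  by case: sg; rewrite ?in_nil // inE => /eqP ->.
rewrite mem_cat => /orP[] /IHk; apply=> //.
by rewrite addn1 expnS mul2n oddD odd_double addbF.
Qed.

(** The two translated halves never meet, since the newest step exceeds the span of the smaller
    cube. *)
Lemma signed_cube_uniq sg k x : uniq (signed_cube sg k x).
Proof.
elim: k sg x => [|k IHk] sg x /=; first by case: sg.
rewrite cat_uniq !IHk andbT /=; apply/hasPn => y /signed_cube_range y_low.
apply/negP => /signed_cube_range; have := cube_span_lt k; lia.
Qed.

Lemma size_signed_cube sg k x : size (signed_cube sg k.+1 x) = 2 ^ k.
Proof.
elim: k sg x => [|k IHk] sg x; first by case: sg.
move: IHk; rewrite -/(signed_cube _ _ _) => IHk.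
by rewrite [signed_cube _ _ _]/(_ ++ _) size_cat !IHk expnS mul2n addnn.
Qed.

End Powers.

(** * Iterated differences of powers *)

Definition cube_diff (k e x : nat) : int :=
  (power_sum e (signed_cube true k x))%:Z - (power_sum e (signed_cube false k x))%:Z.

Lemma cube_diffS k e x :
  cube_diff k.+1 e x = cube_diff k e (x + 2 ^ (2 * k + 1)) - cube_diff k e x.
Proof. rewrite /cube_diff /= !power_sum_cat /=; lia. Qed.

Lemma cube_diff0 e x : cube_diff 0 e x = x%:Z ^+ e.
Proof. by rewrite /cube_diff /= /power_sum big_nil big_seq1 subr0 -!natz natrX. Qed.

(** For [k = 0] this is the binomial theorem; taking differences in [x] preserves the identity. *)
Lemma cube_diff_shift k e x h :
  cube_diff k e (x + h) =
    \sum_(j < e.+1) (h%:Z ^+ (e - j) *+ 'C(e, j)) * cube_diff k j x.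
Proof.
elim: k x => [|k IHk] x.
  rewrite cube_diff0 PoszD addrC exprDn; apply: eq_bigr => j _.
  by rewrite cube_diff0 mulrnAl.
rewrite cube_diffS addnAC !IHk -sumrB; apply: eq_bigr => j _.
by rewrite -mulrBr cube_diffS.
Qed.

(** In the expansion of a further difference the term [j = e] cancels and lower degrees vanish by
    induction. Only for [e = k.+1] does a term survive, [j = k], with factor (k + 1) 2^(2k+1); the
    exponents 1 + 3 + ... add up to a square. *)
Lemma cube_diffE k e x : (e <= k)%N ->
  cube_diff k e x = ((e == k) * (k`! * 2 ^ (k ^ 2)))%N%:Z.
Proof.
elim: k e x => [|k IHk] e x; first by rewrite leqn0 => /eqP ->; rewrite cube_diff0.
move=> ek; rewrite cube_diffS cube_diff_shift big_ord_recr /=.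
rewrite subnn expr0 binn mulr1n mul1r addrK.
case: eqP => [->|e_neq]; last first.
  rewrite big1 // => j _; rewrite IHk; last by have := ltn_ord j; lia.
  by rewrite (_ : (_ == k) = false) ?mulr0 //; have := ltn_ord j; lia.
rewrite big_ord_recr big1 /= => [|j _]; last first.
  by rewrite IHk 1?ltnW // (ltn_eqF (ltn_ord j)) mulr0.
rewrite IHk // eqxx subSnn expr1 binSn add0r !mul1n.
rewrite (_ : k.+1 ^ 2 = k ^ 2 + (2 * k + 1))%N; last by lia.
rewrite !expnD factS -mulr_natr natz -!PoszM; congr Posz; ring.
Qed.

Lemma power_sum_cube n x :
  (power_sum n (signed_cube true n x) =
   power_sum n (signed_cube false n x) + n`! * 2 ^ (n ^ 2))%N.
Proof. by have := @cube_diffE n n x (leqnn n); rewrite /cube_diff eqxx; lia. Qed.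

(** * Chains of disjoint cubes *)

Section Blocks.
Local Open Scope nat_scope.
Variables (n : nat).

(* [c] consecutive cubes: the first [t] contribute their positive vertices, the
   others their negative ones. *)
Fixpoint block_chain (c t x : nat) : seq nat :=
  if c is c'.+1 then
    signed_cube (0 < t) n x ++ block_chain c' t.-1 (x + (cube_span n + 2))
  else [::].

(** The last cube is also followed by a gap of 2. With [c = b - 1] this slack turns 2(b - 1) into
    the 2(b - 2) of the bound. *)
Lemma block_chain_range c t x y : y \in block_chain c t x ->
  x <= y /\ y + 2 <= x + c * (cube_span n + 2).
Proof.
elim: c t x => [|c IHc] t x //=.
rewrite mem_cat => /orP[/signed_cube_range|/IHc]; rewrite mulSn; lia.
Qed.

Lemma block_chain_even c t x y :
  ~~ odd x -> y \in block_chain c t x -> ~~ odd y.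
Proof.
elim: c t x => [|c IHc] t x x_even //=.
rewrite mem_cat => /orP[/signed_cube_even|/IHc]; apply=> //.
(* This identity forces [cube_span n] to be even, so the stride preserves parity. *)
have := cube_spanE n; lia.
Qed.

Lemma block_chain_uniq c t x : uniq (block_chain c t x).
Proof.
elim: c t x => [|c IHc] t x //=.
rewrite cat_uniq signed_cube_uniq IHc andbT /=; apply/hasPn => y.
move=> /block_chain_range[y_low _]; apply/negP => /signed_cube_range; lia.
Qed.

Lemma size_block_chain c t x : 0 < n -> size (block_chain c t x) = c * 2 ^ n.-1.
Proof.
move=> n_gt0; elim: c t x => [|c IHc] t x //.
rewrite /= size_cat IHc mulSn; congr (_ + _).
by rewrite -(prednK n_gt0) size_signed_cube.
Qed.

Lemma power_sum_block_chain c t x : t <= c ->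
  power_sum n (block_chain c t x) =
  power_sum n (block_chain c 0 x) + t * (n`! * 2 ^ (n ^ 2)).
Proof.
elim: c t x => [|c IHc] t x; first by rewrite leqn0 => /eqP ->; rewrite addn0.
case: t => [|t] tc /=; first by rewrite addn0.
rewrite !power_sum_cat (IHc t) // ltnn power_sum_cube mulSn; lia.
Qed.

End Blocks.

(** * Residues modulo [a] from digits in base 2^n *)

Section Residues.
Local Open Scope nat_scope.

(** Induction on the number of digits, peeling off the leading one. The residue of [x] modulo [a]
    records its digit position, which keeps numbers serving different positions distinct. *)
Lemma residue_system (n a q v I : nat) :
  0 < n -> q = 2 ^ n - 1 -> 2 ^ I <= a -> v < 2 ^ (n * I) ->
  exists s : seq nat,
    [/\ uniq s,
        forall x, x \in s -> exists2 i, i < I & x %% a = 2 ^ i,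
        forall x, x \in s -> x < q * a,
        power_sum n s = v %[mod a]
      & power_sum n s <= I * (q * (q * a) ^ n)].
Proof.
move=> n_gt0 qE; elim: I v => [|I IHI] v Ia v_lt.
  exists [::]; split=> //; last by rewrite /power_sum big_nil.
  by move: v_lt; rewrite muln0 expn0 ltnS leqn0 => /eqP ->; rewrite /power_sum big_nil.
have Ia' : 2 ^ I < a by apply: leq_trans Ia; rewrite ltn_exp2l.
pose B := 2 ^ (n * I); have B_gt0 : 0 < B by rewrite expn_gt0.
have [|s [s_uniq s_mod s_lt s_sum s_le]] := IHI (v %% B) (ltnW Ia').
  by rewrite ltn_mod.
set d := v %/ B.
have d_lt : d <= q.
  rewrite qE -ltnS subn1 prednK ?expn_gt0 //.
  by rewrite /d ltn_divLR // /B -expnD -mulnS.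
(* The leading digit [d] is realised by [d] distinct numbers congruent to 2^I. *)
pose f k := 2 ^ I + k * a; pose s' := map f (iota 0 d).
have f_mod k : f k %% a = 2 ^ I by rewrite /f addnC modnMDl modn_small.
have s'_lt x : x \in s' -> x < q * a.
  case/mapP => k; rewrite mem_iota /= add0n => kd ->; rewrite /f.
  apply: leq_trans (leq_mul (leq_trans kd d_lt) (leqnn a)).
  by rewrite mulSn ltn_add2r.
have s'_sum : power_sum n s' = d * B %[mod a].
  rewrite /power_sum big_map /B.
  have -> : d * 2 ^ (n * I) = \sum_(k <- iota 0 d) (2 ^ I) ^ n.
    by rewrite big_const_seq count_predT size_iota iter_addn_0 -expnM mulnC [I * n]mulnC.
  by rewrite -modn_summ; under eq_bigr => k _ do rewrite -modnXm f_mod; rewrite modn_summ.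
exists (s' ++ s); split.
- rewrite cat_uniq s_uniq andbT map_inj_uniq ?iota_uniq /=; last first.
    move=> k l; rewrite /f => /addnI /eqP; rewrite eqn_pmul2r ?(leq_ltn_trans _ Ia') //.
    by move/eqP.
  apply/hasPn => x /s_mod[i iI x_mod]; apply/negP => /mapP[k _ xE].
  by move: x_mod; rewrite xE f_mod => /eqP; rewrite eqn_exp2l // gtn_eqF.
- move=> x; rewrite mem_cat => /orP[/mapP[k _ ->]|/s_mod[i iI ->]].
    by exists I.
  by exists i; rewrite // ltnW.
- by move=> x; rewrite mem_cat => /orP[/s'_lt|/s_lt].
- by rewrite power_sum_cat -modnDm s'_sum s_sum modnDm -divn_eq.
- rewrite power_sum_cat mulSn leq_add //.
  apply: leq_trans (power_sum_le n s' (q * a) _) _; first by move=> x /s'_lt/ltnW.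
  by rewrite size_map size_iota leq_mul2r d_lt orbT.
Qed.

End Residues.

(** * Greedy sums of powers of odd numbers *)

Section Greedy.
Local Open Scope nat_scope.

Lemma expn_add2_le (n y : nat) : 4 * n <= y -> 0 < y -> (y + 2) ^ n <= 2 * y ^ n.
Proof.
move=> ny y_gt0.
(* Bernoulli's inequality in the form (1 + 2/y)^m (1 - 2m/y) <= 1, with denominators cleared. *)
have main m : 4 * m <= y -> (y + 2) ^ m * (y - 2 * m) <= y ^ m * y.
  elim: m => [|m IHm] my; first by rewrite !expn0; lia.
  have {}IHm := IHm (ltac:(lia)).
  have step : (y + 2) * (y - 2 * m.+1) <= y * (y - 2 * m).
    have [z yE] : exists z, y = z + 2 * m.+1 by exists (y - 2 * m.+1); lia.
    have -> : y - 2 * m.+1 = z by lia.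
    by have -> : y - 2 * m = z + 2; nia.
  rewrite !expnS -!mulnA; apply: leq_trans (leq_mul (leqnn y) IHm).
  by rewrite mulnCA [y * _]mulnCA leq_mul2l step orbT.
rewrite -(leq_pmul2r y_gt0); move: (main n ny).
have : y <= 2 * (y - 2 * n) by lia.
move: (y - _) ((y + 2) ^ n) (y ^ n) => z u w /(leq_mul (leqnn u)) uy uz.
by apply: leq_trans uy _; rewrite mulnCA -mulnA leq_mul2l.
Qed.

Lemma odd_sums_dense (n r t : nat) :
  4 * n <= r.+1 -> ~~ odd r ->
  exists s : seq nat,
    [/\ uniq s, forall x, x \in s -> odd x && (r < x)
      & power_sum n s <= t < power_sum n s + r.+1 ^ n].
Proof.
move=> nr r_even.
pose w k := (r.+1 + 2 * k) ^ n.
pose g k := r.+1 ^ n + \sum_(i < k) w i.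
have gS k : g k.+1 = g k + w k by rewrite /g big_ord_recr addnA.
have w_double k : w k.+1 <= 2 * w k.
  by rewrite /w mulnS addnA addnAC; apply: expn_add2_le; lia.
(* Doubling gives w (k+1) <= 2 w k <= g k + w k = g (k+1). Hence whenever [g k] is reached, the term
   [w k] can be subtracted, and below [g k.+1] the remainder falls under [g k]. *)
have g_ge k : w k <= g k.
  elim: k => [|k IHk]; first by rewrite /g big_ord0 addn0 /w muln0 addn0.
  by rewrite gS; have := w_double k; lia.
have w_gt0 k : 0 < w k by rewrite expn_gt0.
suff main k : t < g k -> exists s : seq nat,
    [/\ uniq s, forall x, x \in s -> odd x && (r < x),
        forall x, x \in s -> x < r.+1 + 2 * k
      & power_sum n s <= t < power_sum n s + r.+1 ^ n].
  have t_lt : t < g t.+1.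
    elim: {w_double g_ge main}t => [|u IHu]; first by rewrite gS; have := w_gt0 0; lia.
    by rewrite gS; have := w_gt0 u.+1; lia.
  by have [s [? ? _ ?]] := main _ t_lt; exists s.
elim: k t => [|k IHk] u; first rewrite /g big_ord0 addn0 => u_lt.
  by exists [::]; split; rewrite // /power_sum big_nil; lia.
have [u_lt _|u_ge u_lt] := ltnP u (g k).
  have [s [? ? s_lt ?]] := IHk u u_lt.
  by exists s; split=> // x /s_lt; lia.
have w_u : w k <= u by apply: leq_trans u_ge.
have [|s [s_uniq s_odd s_lt s_sum]] := IHk (u - w k).
  by move: u_lt; rewrite gS; lia.
exists (r.+1 + 2 * k :: s); split.
- rewrite cons_uniq s_uniq andbT; apply/negP => /s_lt; lia.
- by move=> x; rewrite inE => /orP[/eqP ->|/s_odd //]; lia.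
- by move=> x; rewrite inE => /orP[/eqP ->|/s_lt]; lia.
- by rewrite /power_sum big_cons -/(w k) -/(power_sum n s); lia.
Qed.

End Greedy.

(** * From lists of numbers to subset sums and thresholds *)

Lemma subset_sum_power_sum (n : nat) (s : seq nat) :
  uniq s -> 0%N \notin s -> s != [::] ->
  subset_sum (power_seq n) (power_sum n s)%:Z.
Proof.
move=> s_uniq s_pos s_neq0.
pose N := \max_(x <- s) x.
exists (fun k => k.+1 \in s), N; split.
- move=> k Nk; apply/negP => ks.
  by have := @leq_bigmax_seq _ s xpredT id _ ks isT; rewrite -/N; lia.
- case: s s_pos s_neq0 {s_uniq N} => [|[|x] s] //.
  by exists x; rewrite mem_head.
have s_perm : perm_eq s [seq k.+1 | k <- iota 0 N & k.+1 \in s].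
  apply: uniq_perm => //.
    by rewrite map_inj_uniq ?filter_uniq ?iota_uniq // => ? ? [].
  move=> x; apply/idP/mapP => [xs|[k]]; last by rewrite mem_filter => /andP[? _] ->.
  have x_gt0 : (0 < x)%N by case: x xs s_pos => // ->.
  exists x.-1; last by rewrite prednK.
  rewrite mem_filter prednK // xs mem_iota /= add0n prednK //.
  exact: (@leq_bigmax_seq _ s xpredT id).
rewrite /power_sum (perm_big _ s_perm) big_map big_filter -natz natr_sum.
rewrite -[in iota _ _](subn0 N) -/(index_iota 0 N) big_mkord big_mkcond /=.
by apply: eq_bigr => k _; case: ifP; rewrite ?mul0r // mul1r natrX natz.
Qed.

Lemma subset_sum_power_seq_gt0 (n : nat) (m : int) :
  subset_sum (power_seq n) m -> 0 < m.
Proof.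
move=> [eps [N [eps0 [k epsk] ->]]].
have kN : (k < N)%N by rewrite ltnNge; apply/negP => /eps0; rewrite epsk.
have pow_gt0 i : 0 < power_seq n i by rewrite exprn_gt0.
rewrite (bigD1 (Ordinal kN)) //= epsk mul1r ltr_wpDr // sumr_ge0 // => i _.
by rewrite mulr_ge0 ?ler0n // ltW.
Qed.

(** Descend from [B] to the first non-sum; the descent stops because 0 is not a sum. *)
Lemma exists_threshold (s : nat -> int) (B : nat) :
  ~ subset_sum s 0 -> (forall m : nat, (B <= m)%N -> subset_sum s m%:Z) ->
  exists theta : int, is_threshold s theta /\ theta < B%:Z.
Proof.
move=> s0; elim: B => [|B IHB] sB; first by case: s0; apply: sB.
have [sBB|s_not] := classic (subset_sum s B%:Z).
  have [m|theta [? theta_lt]] := IHB.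
    by rewrite leq_eqVlt => /orP[/eqP <- //|]; apply: sB.
  by exists theta; split=> //; lia.
exists B%:Z; split; last by lia.
split=> //; first by exists B.+1%:Z => -[m|m] // Bm; apply: sB; lia.
move=> m sm; rewrite leNgt; apply/negP => Bm; apply: sm.
by case: m Bm => // m Bm; apply: sB; lia.
Qed.

(** * Estimates for powers of 2 and factorials *)

Lemma exp2_pred_bound (n : nat) : (1 < n)%N ->
  (4 * n * (2 ^ n - 1) ^ n.+1 <= 2 ^ (n ^ 3))%N.
Proof.
(* The case [n = 2] is computed (216 <= 256): the crude exponent (n + 1)^2 used below is at most n^3
   only from 3 on. *)
case: n => [|[|[|n]]] // _; set k := n.+3.
have k4 : (4 * k <= 2 ^ k.+1)%N.
  by rewrite expnS; have := ltn_expl n.+1 (ltnSn 1); rewrite /k !expnS; lia.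
have le_pow : ((2 ^ k - 1) ^ k.+1 <= 2 ^ (k * k.+1))%N.
  by rewrite expnM leq_expn2r ?leq_subr.
apply: leq_trans (leq_mul k4 le_pow) _.
by rewrite -expnD leq_exp2l // /k; nia.
Qed.

Lemma fact_le_exp2 (n : nat) : (n`! <= 2 ^ (n ^ 2))%N.
Proof.
elim: n => // n IHn; rewrite factS (_ : n.+1 ^ 2 = n.+1 + n + n ^ 2)%N; last by lia.
rewrite expnD leq_mul // expnD.
by apply: leq_trans (ltnW (ltn_expl _ _)) (leq_pmulr _ _); rewrite ?expn_gt0.
Qed.

(** * Parameter inequalities and representation of large integers *)

Section Representation.
Local Open Scope nat_scope.

Lemma parameter_bounds (n a b r q : nat) : 1 < n ->
  a = n`! * 2 ^ (n ^ 2) -> b = 2 ^ (n ^ 3) * a ^ (n - 1) ->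
  r = 2 ^ (n ^ 2 - n) * a -> q = 2 ^ n - 1 ->
  [/\ 1 < b, 2 ^ (2 * n) <= a, 4 * n <= a, q * a < r
    & 2 * n * (q * (q * a) ^ n) + r.+1 ^ n <= a * b] /\ 2 * a <= r.+1 ^ n.
Proof.
move=> n_gt1.
have n_gt0 : 0 < n := ltnW n_gt1.
have n_lt : n < 2 ^ n by rewrite ltn_expl.
have n_sq : 2 * n <= n ^ 2 by rewrite -mulnn leq_mul2r n_gt1 orbT.
have n_sq_split : n ^ 2 = 2 + (n - 2) + (n ^ 2 - n) by lia.
have n_sub : n <= n ^ 2 - n by lia.
have gapC := exp2_pred_bound n n_gt1.
move=> aE bE rE qE; rewrite -qE in gapC.
have a_ge : 2 ^ (n ^ 2) <= a by rewrite aE leq_pmull ?fact_gt0.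
have a_ge2n : 2 ^ (2 * n) <= a by apply: leq_trans a_ge; rewrite leq_exp2l.
have a_ge4n : 4 * n <= a.
  apply: leq_trans a_ge2n; rewrite mul2n -addnn expnD leq_mul ?(ltnW n_lt) //.
  by rewrite -[4]/(2 ^ 2) leq_exp2l.
have a_gt0 : 0 < a by apply: leq_trans a_ge; rewrite expn_gt0.
have q_gt0 : 0 < q by rewrite qE subn_gt0 (leq_ltn_trans n_gt0).
have q_lt : q < 2 ^ (n ^ 2 - n).
  apply: (@leq_trans (2 ^ n)); last by rewrite leq_exp2l.
  by rewrite qE subn1 prednK ?expn_gt0.
have qa_lt : q * a < r by rewrite rE ltn_pmul2r.
have r_gt : a < r by apply: leq_ltn_trans qa_lt; rewrite leq_pmull.
have abE : a * b = 2 ^ (n ^ 3) * a ^ n by rewrite bE mulnCA -expnS subn1 prednK.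
have C_le : 2 * (2 * n * (q * (q * a) ^ n)) <= a * b.
  suff -> : 2 * (2 * n * (q * (q * a) ^ n)) = 4 * n * q ^ n.+1 * a ^ n.
    by rewrite abE leq_mul.
  by rewrite expnMn expnS; ring.
(* C and D are each at most half of [a * b]. Here 2(r + 1) <= 4r <= 2^n r = 2^(n^2) a is raised to
   the power [n]. *)
have D_le : 2 * r.+1 ^ n <= a * b.
  have r4 : 2 * r.+1 <= 2 ^ (n ^ 2) * a.
    rewrite n_sq_split !expnD -!mulnA -rE.
    have : 0 < 2 ^ (n - 2) by rewrite expn_gt0.
    have : 0 < r by apply: leq_trans r_gt.
    by move: (2 ^ (n - 2)); clear; nia.
  rewrite abE expnSr expnM -expnMn; apply: leq_trans (leq_expn2r n _ _ r4).
  rewrite expnMn.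
  by rewrite leq_mul // -[leqLHS]expn1 leq_exp2l.
have D_ge : 2 * a <= r.+1 ^ n.
  apply: (@leq_trans (r.+1 ^ 2)); last by rewrite leq_exp2l // ltnS (leq_trans _ r_gt).
  by move: r_gt a_gt0; rewrite expnS expn1; clear; nia.
do 2!split=> //.
  rewrite bE; apply: (@leq_trans (2 ^ (n ^ 3))); last by rewrite leq_pmulr ?expn_gt0 ?a_gt0.
  by rewrite -[X in X < _](expn0 2) ltn_exp2l ?expn_gt0 ?n_gt0.
by move: C_le D_le; clear; lia.
Qed.

Lemma representable (n a b r m : nat) : 1 < n ->
  a = n`! * 2 ^ (n ^ 2) -> b = 2 ^ (n ^ 3) * a ^ (n - 1) ->
  r = 2 ^ (n ^ 2 - n) * a ->
  (b - 1) * 2 ^ (n - 1) * (r + (b - 1) * cube_span n + 2 * (b - 2)) ^ n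
    + (a * b - 2 * a) <= m ->
  exists s, [/\ uniq s, 0 \notin s, s != [::] & power_sum n s = m].
Proof.
move=> n_gt1 aE bE rE; have n_gt0 := ltnW n_gt1.
have [q qE] : exists q, q = 2 ^ n - 1 by exists (2 ^ n - 1).
have [[b_gt1 a_ge a_ge4n qa_lt CD_le] D_ge] := @parameter_bounds n a b r q n_gt1 aE bE rE qE.
have a_gt0 : 0 < a by apply: leq_trans a_ge; rewrite expn_gt0.
have r_even : ~~ odd r.
  by rewrite rE oddM oddX orbF subn_eq0 leqNgt -{1}[n]expn1 ltn_exp2l.
have a_lt : a <= r.
  by rewrite rE leq_pmull // expn_gt0.
clear bE rE; set X := r + _ + _ => m_ge.
have M_le : power_sum n (block_chain n (b - 1) 0 r) <= (b - 1) * 2 ^ (n - 1) * X ^ n.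
  have := @power_sum_le n (block_chain n (b - 1) 0 r) X.
  rewrite size_block_chain // -subn1; apply=> x /block_chain_range[_].
  by rewrite /X mulnDr; move: b_gt1; clear; lia.
move: (2 * n * _) (fun v => @residue_system n a q v (2 * n)) CD_le => C residues CD_le.
set M := power_sum n _ in M_le.
(* The term -2a of the bound is affordable: C <= ab - D and D >= 2a. *)
have MC_le : M + C <= m by move: m_ge M_le CD_le D_ge; clear; lia.
have r_ge4n : 4 * n <= r.+1 by apply: leq_trans a_ge4n (leqW a_lt).
(* Aiming at [m - M - C] leaves a rest between C and C + D: enough to subtract the residue
   correction [u], yet below [a * b], so that [t < b]. *)
have [w [w_uniq w_mem w_sum]] := @odd_sums_dense n r (m - M - C) r_ge4n r_even.
(* Since n! <= 2^(n^2), residues modulo [a] have at most 2n digits in base 2^n. *)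
have v_lt : (m - M - power_sum n w) %% a < 2 ^ (n * (2 * n)).
  apply: leq_trans (ltn_pmod _ a_gt0) _.
  rewrite (_ : n * (2 * n) = n ^ 2 + n ^ 2); last by lia.
  by rewrite expnD aE leq_mul2r fact_le_exp2 orbT.
have [u [u_uniq u_mod u_lt u_sum u_le]] := residues _ n_gt0 qE a_ge v_lt.
rewrite modn_mod in u_sum.
have u_le_rest : power_sum n u <= m - M - power_sum n w.
  by move: w_sum u_le MC_le; clear; lia.
have [t tE] : exists t, m - M - power_sum n w = power_sum n u + t * a.
  exists ((m - M - power_sum n w - power_sum n u) %/ a).
  by rewrite divnK ?subnKC // -eqn_mod_dvd ?u_sum.
have t_lt : t <= b - 1.
  suff : t < b by clear; lia.
  rewrite -(ltn_pmul2r a_gt0) [b * a]mulnC.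
  by move: tE w_sum CD_le MC_le; clear; lia.
exists (block_chain n (b - 1) t r ++ u ++ w); split.
(* Elements of [u] lie below [r], those of the chain and of [w] do not; chain and [w] differ in
   parity. *)
- rewrite !cat_uniq block_chain_uniq u_uniq w_uniq /= andbT; apply/andP; split.
    apply/hasPn => x; rewrite mem_cat => /orP[/u_lt x_lt|/w_mem/andP[x_odd _]]; apply/negP.
      by case/block_chain_range; rewrite leqNgt (ltn_trans x_lt qa_lt).
    by move/block_chain_even => /(_ r_even); rewrite x_odd.
  apply/hasPn => x /w_mem/andP[_ rx]; apply/negP => /u_lt/(ltn_trans rx).
  by rewrite ltnNge (ltnW qa_lt).
- rewrite !mem_cat !negb_or; apply/and3P; split; apply/negP.
  + by case/block_chain_range; rewrite leqNgt (leq_trans a_gt0 a_lt).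
  + by case/u_mod => i _; rewrite mod0n => /esym/eqP; rewrite expn_eq0.
  + by move/w_mem.
- rewrite -size_eq0 size_cat size_block_chain // addn_eq0 muln_eq0 expn_eq0.
  by rewrite subn_eq0 leqNgt b_gt1.
- by rewrite !power_sum_cat power_sum_block_chain // -/M -aE; move: tE w_sum MC_le; clear; lia.
Qed.

End Representation.

Theorem theorem1 (n : nat) (hn : (1 < n)%N) :
  let a : rat := n`!%:R * 2 ^+ (n ^ 2) in
  let b : rat := 2 ^+ (n ^ 3) * a ^+ (n - 1) in
  let r : rat := 2 ^+ (n ^ 2 - n) * a in
  exists theta : int,
    is_threshold (power_seq n) theta /\
    theta%:~R <
      (b - 1) * 2 ^+ (n - 1)
        * (r + 2 / 3 * (b - 1) * (2 ^+ (2 * n) - 1) + 2 * (b - 2)) ^+ n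
      - 2 * a + a * b.
Proof.
move=> a b r.
pose a' := (n`! * 2 ^ (n ^ 2))%N.
pose b' := (2 ^ (n ^ 3) * a' ^ (n - 1))%N.
pose r' := (2 ^ (n ^ 2 - n) * a')%N.
have aE : a = a'%:R by rewrite natrM natrX.
have bE : b = b'%:R by rewrite natrM !natrX -aE.
have rE : r = r'%:R by rewrite natrM natrX -aE.
have a_gt0 : (0 < a')%N by rewrite muln_gt0 fact_gt0 expn_gt0.
have b_gt1 : (1 < b')%N.
  apply: (@leq_trans (2 ^ (n ^ 3))); last by rewrite leq_pmulr ?expn_gt0 ?a_gt0.
  by rewrite -[X in (X < _)%N](expn0 2) ltn_exp2l ?expn_gt0 //; lia.
set T := ((b' - 1) * 2 ^ (n - 1) * (r' + (b' - 1) * cube_span n + 2 * (b' - 2)) ^ n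
    + (a' * b' - 2 * a'))%N.
have [||theta [theta_thr theta_lt]] := @exists_threshold (power_seq n) T.
- by move/subset_sum_power_seq_gt0.
- move=> m /(representable n a' b' r' _ hn erefl erefl erefl)[s [? ? ? <-]].
  exact: subset_sum_power_sum.
exists theta; split=> //; clearbody a b r a' b' r'.
suff <- : T%:R = (b - 1) * 2 ^+ (n - 1)
        * (r + 2 / 3 * (b - 1) * (2 ^+ (2 * n) - 1) + 2 * (b - 2)) ^+ n
      - 2 * a + a * b by rewrite pmulrn ltr_int.
have spanE : 3 * (cube_span n)%:R + 2 = 2 * 2 ^+ (2 * n) :> rat.
  by rewrite -natrX -!natrM -natrD cube_spanE.
have -> : 2 / 3 * (b - 1) * (2 ^+ (2 * n) - 1) = (b - 1) * (cube_span n)%:R.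
  have -> : (cube_span n)%:R = (2 * 2 ^+ (2 * n) - 2) / 3 :> rat by rewrite -spanE; field.
  by field.
(* The truncated subtraction in [T] is exact because [b' > 1] gives 2a <= ab. *)
rewrite natrD natrB; last by rewrite mulnC leq_mul2l b_gt1 orbT.
rewrite aE bE rE !(natrM, natrX, natrD) !natrB ?natrM //; last exact: ltnW.
ring.
Qed.
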